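(* For each integer $t \geq 2$ there exists a real Hadamard matrix $M$ of order $n_t = 2^{2^{t-1}-1}$ such that the minimal polynomial of the matrix $n_t^{-1/2} M$ is the cyclotomic polynomial $\Phi_{2^{t+1}}(x) = x^{2^t}+1$.
   Context: A real Hadamard matrix of order $n$ is an $n \times n$ matrix $M$ with all entries in $\{1,-1\}$ such that $MM^{\top} = nI_n$. $\Phi_k(x)$ denotes the $k$-th cyclotomic polynomial. The minimal polynomial of a square matrix $B$ is the monic polynomial $f$ of least degree with $f(B) = 0$. *)

(* Defs.v *)
From HB Require Import structures.
From mathcomp Require Export all_boot all_order all_algebra all_field.
From mathcomp Require Export reals.

Set Implicit Arguments.
Unset Strict Implicit.
Unset Printing Implicit Defensive.

Import Order.TTheory GRing.Theory Num.Theory.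
Local Open Scope ring_scope.

Definition hadamard (R : realType) (n : nat) (M : 'M[R]_n) : Prop :=
  (forall i j, M i j = 1 \/ M i j = - 1) /\ M *m M^T = n%:R%:M.

(* The minimal polynomial is taken over the rationals, although the matrix is
   real.  It can differ from [mxminpoly B], the minimal polynomial over R,
   whose degree is at most the order of B: for the 2 x 2 rotation by pi/4 it
   is 'X^4 + 1 over rat, but 'X^2 - sqrt 2 'X + 1 over R. *)
Definition is_minpoly_rat (R : realType) (n : nat) (B : 'M[R]_n.+1)
    (f : {poly rat}) : Prop :=
  [/\ f \is monic,
      horner_mx B (map_poly ratr f) = 0
    & forall g : {poly rat}, g \is monic ->
        horner_mx B (map_poly ratr g) = 0 -> (size f <= size g)%N].

(* Main.v *)
From mathcomp Require Import ring zify.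
Require Import Defs.

(** The polynomial 'Phi_(2 ^ t.+1) = 'X^(2 ^ t) + 1 is irreducible over rat, so
    it is the rational minimal polynomial of every matrix that it annihilates
    ([is_minpoly_rat_Cyclotomic]).  With n = 2 ^ (2 ^ (t - 1) - 1), it is
    therefore enough to find a Hadamard matrix M of order n such that
    M ^+ (2 ^ t) = - n ^ (2 ^ (t - 1)), since the left side divided by
    sqrt n ^+ (2 ^ t) is then - 1.

    For t = 2 the rotation matrix with rows (1, 1) and (-1, 1) works.

    For t >= 3, roots of - 1 of large order are easy to produce among signed
    permutation matrices: a cyclic shift of 2 ^ e coordinates that changes one
    sign has its power 2 ^ e equal to - 1.  Such matrices have many zero
    entries, and two devices turn them into a Hadamard matrix.

    First, a signed permutation D factors, up to a scalar, as a product of two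
    Hadamard matrices: if K is symmetric Hadamard of order q, and L = D K, then
    L K = q D.  The pairs (K, L) are the seeds below; D itself never appears.
    Doubling K in the manner of Sylvester, and D either as a direct sum D + D
    or as the block matrix with rows (0, D) and (1, 0), whose square is D + D,
    gives seeds of order 2 ^ s with (L K / q) ^+ (2 ^ e) = - 1 whenever e <= s
    ([seed_exists]).

    Secondly, let B = diag(L, K) and let C be antidiagonal with both blocks K.
    Up to the scale q, these are orthogonal with complementary supports, so
    that B + C and B - C have all entries 1 or - 1.  Conjugating the block
    matrix with rows (0, B) and (C, 0) by the matrix with rows (1, 1) and
    (1, - 1) produces [mix_mx B C], all of whose entries are entries of B + C
    or B - C up to sign, and which is Hadamard of order 4 q.  The square of
    the block matrix is diag(B C, C B); in turn B C is antidiagonal with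
    blocks L K and q, so its square is diag(q L K, q L K).  Thus the fourth
    power of [mix_mx B C] is similar to copies of D up to a scalar, and
    taking q = 2 ^ (2 ^ (t - 1) - 3) and e = t - 2 yields the claim
    ([hadamard_of_seed]); the condition e <= s on the seed then reads
    t - 2 <= 2 ^ (t - 1) - 3, which holds from t = 3 on. *)

Import Order.TTheory GRing.Theory Num.Theory.
Local Open Scope ring_scope.

Set Implicit Arguments.
Unset Strict Implicit.
Unset Printing Implicit Defensive.

(** * Powers of block matrices *)

Lemma exp_scalemx (R : realType) n (c : R) (A : 'M[R]_n) k :
  (c *: A) ^+ k = c ^+ k *: A ^+ k.
Proof.
elim: k => [|k IHk]; first by rewrite !expr0 scale1r.
by rewrite !exprS IHk -[LHS]/(_ *m _) -scalemxAl -scalemxAr scalerA.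
Qed.

Lemma exp_intertwine (R : realType) n (A N H : 'M[R]_n) k :
  A *m H = H *m N -> A ^+ k *m H = H *m N ^+ k.
Proof.
move=> AH; elim: k => [|k IHk]; first by rewrite !expr0 mulmx1 mul1mx.
by rewrite !exprSr -[A ^+ k * A]/(_ *m _) -mulmxA AH mulmxA IHk -mulmxA.
Qed.

Lemma exp_diag_block (R : realType) n (A B : 'M[R]_n) k :
  (block_mx A 0 0 B) ^+ k = block_mx (A ^+ k) 0 0 (B ^+ k).
Proof.
elim: k => [|k IHk]; first by rewrite !expr0 -scalar_mx_block.
rewrite exprS IHk -[LHS]/(_ *m _) mulmx_block.
by rewrite !(mul0mx, mulmx0, addr0, add0r) !exprS.
Qed.

(** The square of the block matrix is diag(B C, C B).  The matrices B C and C B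
    are conjugate by C, which is invertible by virtue of D, so that a power of
    the first which is scalar equals the same power of the second. *)
Lemma exp_antidiag_block (R : realType) n (B C D : 'M[R]_n) k (a c : R) :
  c != 0 -> C *m D = c%:M -> (B *m C) ^+ k = a%:M ->
  (block_mx 0 B C 0) ^+ (2 * k) = a%:M.
Proof.
move=> c0 CD BCk.
have CBk : (C *m B) ^+ k = a%:M.
  have /(exp_intertwine k) : (C *m B) *m C = C *m (B *m C) by rewrite mulmxA.
  rewrite BCk => /(congr1 (mulmx^~ D)).
  rewrite -!mulmxA mul_scalar_mx CD -scalemxAr CD !mul_mx_scalar scale_scalar_mx.
  move/(congr1 (fun A => c^-1 *: A)).
  by rewrite scalerA mulVf // scale1r scale_scalar_mx mulrC mulfK.
rewrite exprM expr2 -[X in X ^+ _]/(_ *m _) mulmx_block.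
rewrite !(mul0mx, mulmx0, addr0, add0r) exp_diag_block BCk CBk.
by rewrite scalar_mx_block.
Qed.

(** * Mixing two matrices with complementary supports *)

(** With H the matrix with rows (1, 1) and (1, - 1), this is
    H * block_mx 0 (2 B) (2 C) 0 * H^-1. *)
Definition mix_mx (R : realType) n (B C : 'M[R]_n) : 'M[R]_(n + n) :=
  block_mx (B + C) (C - B) (B - C) (- (B + C)).

(** Powers pass through the conjugation by H.  As H ^+ 2 = 2, it can be
    cancelled without introducing its inverse. *)
Lemma exp_mix_mx (R : realType) n (B C : 'M[R]_n) k (a : R) :
  (block_mx 0 B C 0) ^+ k = a%:M -> (mix_mx B C) ^+ k = (2 ^+ k * a)%:M.
Proof.
move=> Na; set H : 'M[R]_(n + n) := block_mx 1%:M 1%:M 1%:M (- 1%:M).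
have HH : H *m H = 2%:M.
  rewrite /H mulmx_block !(mulmx1, mulmxN, mulNmx, opprK) !subrr.
  by rewrite -raddfD /= -scalar_mx_block.
have /(exp_intertwine k) : mix_mx B C *m H = H *m (2 *: block_mx 0 B C 0).
  rewrite /H /mix_mx -scalemxAr !mulmx_block !(mulmx1, mul1mx, mulmx0, mulmxN, mulNmx).
  rewrite scale_block_mx !(add0r, addr0) !scaler_nat !opprK !mulr2n.
  rewrite opprB opprD [C - B]addrC.
  congr block_mx; rewrite addrACA ?subrr ?addNr ?addr0 ?add0r //.
rewrite exp_scalemx Na => /(congr1 (mulmx^~ H)).
rewrite -!mulmxA HH mul_mx_scalar scale_scalar_mx mul_scalar_mx -scalemxAr HH.
move/(congr1 (fun A => 2^-1 *: A)).
rewrite scalerA mulVf ?pnatr_eq0 // scale1r !scale_scalar_mx => ->.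
by congr (_%:M); field.
Qed.

(** * Hadamard matrices from blocks *)

Definition sign_mx (R : realType) m n (A : 'M[R]_(m, n)) :=
  forall i j, A i j = 1 \/ A i j = - 1.

Lemma sign_mxN (R : realType) m n (A : 'M[R]_(m, n)) :
  sign_mx A -> sign_mx (- A).
Proof. by move=> sA i j; rewrite mxE; case: (sA i j) => ->; [right|left]; rewrite ?opprK. Qed.

Lemma sign_mx_block (R : realType) m1 m2 n1 n2 (A : 'M[R]_(m1, n1))
    (B : 'M[R]_(m1, n2)) (C : 'M[R]_(m2, n1)) (D : 'M[R]_(m2, n2)) :
  sign_mx A -> sign_mx B -> sign_mx C -> sign_mx D ->
  sign_mx (block_mx A B C D).
Proof.
move=> sA sB sC sD i j; rewrite -(splitK i) -(splitK j).
case: (split i) => i'; case: (split j) => j' /=.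
- by rewrite block_mxEul.
- by rewrite block_mxEur.
- by rewrite block_mxEdl.
- by rewrite block_mxEdr.
Qed.

Lemma hadamardN (R : realType) n (A : 'M[R]_n) : hadamard A -> hadamard (- A).
Proof.
move=> [sA AA]; split; first exact: sign_mxN.
by rewrite raddfN /= mulmxN mulNmx opprK.
Qed.

Lemma hadamard_block (R : realType) n (A B C D : 'M[R]_n) (c : R) :
    (n + n)%:R = c -> sign_mx A -> sign_mx B -> sign_mx C -> sign_mx D ->
    A *m A^T + B *m B^T = c%:M -> C *m C^T + D *m D^T = c%:M ->
    A *m C^T + B *m D^T = 0 ->
  hadamard (block_mx A B C D).
Proof.
move=> Dc sA sB sC sD AB CD orth; split; first exact: sign_mx_block.
rewrite tr_block_mx mulmx_block AB CD orth Dc scalar_mx_block; congr block_mx.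
by rewrite -[LHS]trmxK raddfD /= !trmx_mul !trmxK orth trmx0.
Qed.

(** The cross terms B C^T and C B^T cancel in the product of [mix_mx B C] with
    its transpose, so only the two diagonal terms B B^T and C C^T, which are
    equal, contribute. *)
Lemma hadamard_mix_mx (R : realType) n (B C : 'M[R]_n) (c : R) :
  n%:R = 2 * c -> sign_mx (B + C) -> sign_mx (B - C) ->
  B *m B^T = c%:M -> C *m C^T = c%:M -> hadamard (mix_mx B C).
Proof.
move=> Dn sD sB BB CC.
have c4 : (4 * c)%:M = c%:M + c%:M + (c%:M + c%:M) :> 'M[R]_n.
  by rewrite -!raddfD /=; congr (_%:M); ring.
apply: (@hadamard_block _ _ _ _ _ _ (4 * c)) => //.
- by rewrite natrD Dn; ring.
- by rewrite -opprB; apply: sign_mxN.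
- exact: sign_mxN.
all: rewrite ?c4 !(raddfD, raddfN) /= !(mulmxDl, mulmxDr, mulNmx, mulmxN, opprK) BB CC.
all: move: (B *m _) (C *m _) (c%:M) => X Y Z.
all: by apply/matrixP => i j; rewrite !mxE; ring.
Qed.

Lemma hadamard_double (R : realType) n (A B : 'M[R]_n) :
  hadamard A -> hadamard B -> hadamard (block_mx A A B (- B)).
Proof.
move=> [sA AA] [sB BB].
apply: (hadamard_block (erefl _)) => //; first exact: sign_mxN.
- by rewrite AA natrD raddfD.
- by rewrite raddfN /= mulmxN mulNmx opprK BB natrD raddfD.
- by rewrite raddfN /= mulmxN subrr.
Qed.

Lemma hadamard_double_signed_left (R : realType) n (A B : 'M[R]_n) :
  hadamard A -> hadamard B -> hadamard (block_mx A (- A) B B).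
Proof.
move=> [sA AA] [sB BB].
apply: (hadamard_block (erefl _)) => //; first exact: sign_mxN.
- by rewrite raddfN /= mulmxN mulNmx opprK AA natrD raddfD.
- by rewrite BB natrD raddfD.
- by rewrite mulNmx subrr.
Qed.

(** * Seeds: scaled roots of -1 as products of two Hadamard matrices *)

(** With D = L K / n, this says that L = D K and D ^+ k = - 1; in the seeds
    constructed below, D is a signed permutation matrix. *)
Record seed (R : realType) n (K L : 'M[R]_n) (k : nat) : Prop := Seed {
  seed_sym : K^T = K;
  seed_hadamard_sym : hadamard K;
  seed_hadamard_factor : hadamard L;
  seed_exp : (L *m K) ^+ k = (- n%:R ^+ k)%:M
}.

Lemma seed_sqr (R : realType) n (K L : 'M[R]_n) k :
  seed K L k -> K *m K = n%:R%:M.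
Proof. by case=> KT [_ <-] _ _; rewrite KT. Qed.

Lemma seed1 (R : realType) : seed (1%:M : 'M[R]_1) (- 1%:M) 1.
Proof.
have h1 : hadamard (1%:M : 'M[R]_1).
  by split=> [i j|]; [left; rewrite !ord1 !mxE | rewrite trmx1 mulmx1].
split=> //; [exact: trmx1 | exact: hadamardN |].
by rewrite mulmx1 !expr1 raddfN.
Qed.

(** Replaces D by the direct sum of two copies of D. *)
Lemma seed_double (R : realType) n (K L : 'M[R]_n) k :
  seed K L k -> seed (block_mx K K K (- K)) (block_mx L L L (- L)) k.
Proof.
case=> KT hK hL LKk; split; try exact: hadamard_double.
  by rewrite tr_block_mx raddfN /= KT.
rewrite mulmx_block !(mulmxN, mulNmx) opprK subrr exp_diag_block.
rewrite -mulr2n -scaler_nat exp_scalemx LKk scale_scalar_mx -scalar_mx_block.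
by congr (_%:M); rewrite mulrN -exprMn mulr_natl natrD.
Qed.

(** Replaces D by the block matrix with rows (0, D) and (1, 0), whose square is
    the direct sum of two copies of D. *)
Lemma seed_twist (R : realType) n (K L : 'M[R]_n) k :
  seed K L k -> (0 < n)%N ->
  seed (block_mx K K K (- K)) (block_mx L (- L) K K) (2 * k).
Proof.
move=> S n0; have KK := seed_sqr S; case: S => KT hK hL LKk.
split; [|exact: hadamard_double|exact: hadamard_double_signed_left|].
  by rewrite tr_block_mx raddfN /= KT.
rewrite mulmx_block !(mulmxN, mulNmx) opprK !subrr KK -[X in block_mx _ X]mulr2n.
rewrite -raddfD -natrD /=.
have nn0 : (n + n)%:R != 0 :> R by rewrite pnatr_eq0 -lt0n addn_gt0 n0.
apply: (exp_antidiag_block nn0 (D := 1%:M)); first by rewrite mulmx1.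
rewrite mul_mx_scalar -scaler_nat !exp_scalemx LKk !scale_scalar_mx.
congr (_%:M); rewrite !mulrN -!exprMn exprM; congr (- _ ^+ _).
by rewrite natrD; ring.
Qed.

(** Each doubling of the order is free to double the exponent as well or not:
    the order 2 ^ s is reached by s - e direct sums followed by e twists. *)
Lemma seed_exists (R : realType) e s : (e <= s)%N ->
  exists n (K L : 'M[R]_n), n = (2 ^ s)%N /\ seed K L (2 ^ e).
Proof.
elim: s e => [|s IHs] e es.
  by move: es; rewrite leqn0 => /eqP->; exists 1%N, 1%:M, (- 1%:M); split=> //; apply: seed1.
case: e es => [|e] es.
  have [n [K [L [Dn S]]]] := IHs 0%N isT.
  by eexists _, _, _; split; last exact: seed_double S; rewrite Dn expnS mul2n addnn.
have [n [K [L [Dn S]]]] := IHs e es.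
have n0 : (0 < n)%N by rewrite Dn expn_gt0.
eexists _, _, _; split; last by rewrite expnS; exact: seed_twist S n0.
by rewrite Dn expnS mul2n addnn.
Qed.

(** * Hadamard matrices with a scalar power *)

(** The exponent 4 k comes from two successive squarings: that of the
    antidiagonal matrix conjugate to M, which leaves B C, and that of B C, which
    is antidiagonal with blocks L K and n. *)
Lemma hadamard_of_seed (R : realType) n (K L : 'M[R]_n) k :
    (0 < n)%N -> seed K L k ->
  let M := mix_mx (block_mx L 0 0 K) (block_mx 0 K K 0) in
  hadamard M /\ M ^+ (4 * k) = (- (n + n + (n + n))%:R ^+ (2 * k))%:M.
Proof.
move=> n0 S M; have KK := seed_sqr S; case: S => KT hK hL LKk.
have [[sK KKT] [sL LLT]] := (hK, hL).
have nn0 : n%:R != 0 :> R by rewrite pnatr_eq0 -lt0n.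
have CC : block_mx 0 K K 0 *m block_mx 0 K K 0 = n%:R%:M.
  by rewrite mulmx_block !(mul0mx, mulmx0, addr0, add0r) KK -scalar_mx_block.
split.
  apply: (@hadamard_mix_mx _ _ _ _ n%:R).
  - by rewrite natrD; ring.
  - by rewrite add_block_mx !(addr0, add0r); apply: sign_mx_block.
  - rewrite opp_block_mx add_block_mx !(addr0, add0r, oppr0).
    by apply: sign_mx_block => //; apply: sign_mxN.
  - rewrite tr_block_mx mulmx_block !trmx0 !(mul0mx, mulmx0, addr0, add0r) KKT LLT.
    by rewrite -scalar_mx_block.
  - by rewrite tr_block_mx !trmx0 KT CC.
have -> : (4 * k = 2 * (2 * k))%N by lia.
rewrite (@exp_mix_mx _ _ _ _ _ (- n%:R ^+ (2 * k))).
  congr (_%:M); rewrite mulrN !exprM -!exprMn; congr (- _ ^+ _).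
  by rewrite !natrD; ring.
apply: (exp_antidiag_block nn0 CC).
(* Now the base is B C, antidiagonal with blocks L K and n. *)
rewrite mulmx_block !(mul0mx, mulmx0, addr0, add0r) KK.
apply: (exp_antidiag_block nn0 (D := 1%:M)); first by rewrite mulmx1.
rewrite mul_mx_scalar exp_scalemx LKk scale_scalar_mx.
by congr (_%:M); rewrite mulrN -exprMn exprM expr2.
Qed.

Lemma hadamard_order2 (R : realType) :
  let M := block_mx 1%:M 1%:M (- 1%:M) (- - 1%:M) : 'M[R]_(1 + 1) in
  hadamard M /\ M ^+ 4 = (- 2 ^+ 2)%:M.
Proof.
have h1 := seed_hadamard_sym (seed1 R); split; first exact/hadamard_double/hadamardN.
(* The square of M is antidiagonal with blocks 2 and - 2. *)
have /esym -> : (2 * 1 * 2 = 4)%N by [].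
rewrite mulnC exprM expr2 -[X in X ^+ _]/(_ *m _) mulmx_block.
rewrite !opprK !(mulmx1, mulmxN) !(subrr, addNr) -opprD -raddfD /=.
apply: (exp_antidiag_block (c := - 2) (D := 1%:M)); first by rewrite oppr_eq0 pnatr_eq0.
  by rewrite mulmx1 raddfN.
by rewrite expr1 mulmxN -scalar_mxM raddfN expr2.
Qed.

Lemma hadamard_root_exists (R : realType) t : (2 <= t)%N ->
  exists n (M : 'M[R]_n),
    [/\ n = (2 ^ (2 ^ (t - 1) - 1))%N, hadamard M
      & M ^+ (2 ^ t) = (- n%:R ^+ (2 ^ (t - 1)))%:M].
Proof.
case: t => [|[|[|u]]] // _.
  by have [hM M4] := hadamard_order2 R; eexists _, _; split; [|exact: hM|].
have u_lt : (u.+1 < 2 ^ u.+1)%N by apply: ltn_expl.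
have [|n [K [L [Dn S]]]] := @seed_exists R u.+1 (2 ^ (u.+3 - 1) - 3).
  by rewrite subn1 /= (expnS 2 u.+1); lia.
have n0 : (0 < n)%N by rewrite Dn expn_gt0.
have [hM powM] := hadamard_of_seed n0 S.
eexists _, _; split; [|exact: hM|].
  have -> : (2 ^ (u.+3 - 1) - 1 = 2 + (2 ^ (u.+3 - 1) - 3))%N.
    by rewrite subn1 /= (expnS 2 u.+1); lia.
  by rewrite expnD -Dn; lia.
have -> : (2 ^ u.+3 = 4 * 2 ^ u.+1)%N by rewrite !expnS; lia.
by rewrite powM subn1 -expnS.
Qed.

(** * Minimal polynomials and cyclotomic polynomials *)

Local Notation QPhi n := (map_poly intr 'Phi_n : {poly rat}).

(** This is the irreducibility of cyclotomic polynomials, in the form used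
    below: the minimal polynomial over rat of a primitive root of unity is
    cyclotomic. *)
Lemma root_ratr_Cyclotomic n (z : algC) (g : {poly rat}) :
  n.-primitive_root z -> root (map_poly ratr g) z = (QPhi n %| g).
Proof.
move=> prim_z; have [p [Dp _] ->] := minCpolyP z.
suff -> : QPhi n = p by [].
apply: (map_poly_inj (@ratr algC)).
rewrite -Dp (minCpoly_cyclotomic prim_z) -(Cintr_Cyclotomic prim_z) -map_poly_comp.
by apply: eq_map_poly => a /=; rewrite rmorph_int.
Qed.

(** A primitive root z of order 2 ^ t.+1 satisfies z ^+ (2 ^ t) = - 1, because
    the left side is a square root of 1 other than 1.  So the cyclotomic
    polynomial divides 'X^(2 ^ t) + 1, and both are monic of degree 2 ^ t. *)
Lemma Cyclotomic_pow2 t : 'Phi_(2 ^ t.+1) = 'X^(2 ^ t) + 1.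
Proof.
have [|z prim_z] := @C_prim_root_exists (2 ^ t.+1); first by rewrite expn_gt0.
have mon1 : ('X^(2 ^ t) + 1 : {poly int}) \is monic.
  by rewrite monicE lead_coefDl ?lead_coefXn // size_polyXn size_poly1 ltnS expn_gt0.
have sz1 : size ('X^(2 ^ t) + 1 : {poly int}) = (2 ^ t).+1.
  by rewrite size_polyDl size_polyXn // size_poly1 ltnS expn_gt0.
have inj : injective (map_poly (intr : int -> rat)).
  by apply: map_inj_poly => //; apply: intr_inj.
have monQ (p : {poly int}) : p \is monic -> (map_poly (intr : int -> rat) p) \is monic.
  exact: monic_map.
apply: inj; apply/eqP; rewrite -eqp_monic ?monQ ?Cyclotomic_monic //.
rewrite -dvdp_size_eqp; last first.
  rewrite -(root_ratr_Cyclotomic _ prim_z) !rmorphD !rmorph1 /= !map_polyXn /root.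
  rewrite hornerD hornerXn hornerC.
  have := prim_expr_order prim_z; rewrite expnSr exprM => /eqP.
  rewrite sqrf_eq1 => /orP[|/eqP->]; last by rewrite addNr.
  by rewrite -(prim_order_dvd prim_z) dvdn_Pexp2l // ltnn.
rewrite !(size_map_inj_poly (@intr_inj _)) // size_Cyclotomic sz1.
by rewrite totient_pfactor // mul1n.
Qed.

(** If 'Phi_k did not divide an annihilating polynomial g, it would be coprime
    to g, being irreducible; a Bezout relation evaluated at B would then give
    1 = 0 in the ring of matrices of positive order. *)
Lemma is_minpoly_rat_Cyclotomic (R : realType) n (B : 'M[R]_n.+1) k :
  (0 < k)%N -> horner_mx B (map_poly ratr (QPhi k)) = 0 ->
  is_minpoly_rat B (QPhi k).
Proof.
move=> k0 B0; have [z prim_z] := C_prim_root_exists k0.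
split=> // [|g mon_g Bg0]; first by apply/monic_map/Cyclotomic_monic.
have g0 := monic_neq0 mon_g.
apply: dvdp_leq => //.
have [//|ndvd] := boolP (QPhi k %| g).
have /Bezout_eq1_coprimepP[[u v] /= uv1] : coprimep (QPhi k) g.
  (* A primitive root of unity is a root of d or of the cofactor of d in 'Phi_k.
     The first is excluded; the second makes the cofactor as large as 'Phi_k
     itself, and hence d constant. *)
  have dPhi := dvdp_gcdl (QPhi k) g; set d := gcdp _ _ in dPhi.
  have Phi0 : QPhi k != 0 by apply/monic_neq0/monic_map/Cyclotomic_monic.
  have nzd : ~~ (QPhi k %| d).
    by apply: contra ndvd => /dvdp_trans; apply; apply: dvdp_gcdr.
  have /esym := root_ratr_Cyclotomic (QPhi k) prim_z.
  rewrite dvdpp -{1}(divpK dPhi) rmorphM rootM !(root_ratr_Cyclotomic _ prim_z).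
  have d0 := dvdpN0 dPhi Phi0.
  have q0 : QPhi k %/ d != 0 by rewrite dvdp_div_eq0.
  rewrite (negPf nzd) orbF => /esym /(dvdp_leq q0).
  rewrite size_divp // /coprimep -/d => szq.
  have := dvdp_leq Phi0 dPhi; have := size_poly_eq0 d.
  rewrite (negPf d0) => /negbT; rewrite -lt0n.
  move: szq; case: (size d) => [//|[//|m]] /= szq _ szd.
  by move: szq; rewrite leqNgt ltn_subrL /= (leq_trans _ szd).
have := congr1 (fun p => horner_mx B (map_poly ratr p)) uv1.
rewrite !(rmorphD, rmorphM, rmorph1) /= B0 Bg0 !mulr0 addr0 => /eqP.
by rewrite eq_sym oner_eq0.
Qed.

Theorem theorem1p4 (R : realType) (t : nat) (ht : (2 <= t)%N) :
  (exists (m : nat) (M : 'M[R]_m.+1),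
    [/\ m.+1 = (2 ^ (2 ^ (t - 1) - 1))%N,
        hadamard M
      & is_minpoly_rat ((Num.sqrt (m.+1%:R : R))^-1 *: M)
          (map_poly intr 'Phi_(2 ^ t.+1))])
  /\ 'Phi_(2 ^ t.+1) = 'X^(2 ^ t) + 1.
Proof.
split; last exact: Cyclotomic_pow2.
have [n [M [Dn hM powM]]] := hadamard_root_exists R ht.
case: n M Dn hM powM => [|m] M Dn hM powM.
  by move/eqP: Dn; rewrite eq_sym expn_eq0.
exists m, M; split=> //; apply: is_minpoly_rat_Cyclotomic; first by rewrite expn_gt0.
have Dt : (2 ^ t = 2 * 2 ^ (t - 1))%N by rewrite -expnS; congr (2 ^ _)%N; lia.
rewrite Cyclotomic_pow2 !rmorphD !rmorph1 /= !map_polyXn rmorphXn /= horner_mx_X.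
rewrite exp_scalemx powM Dt exprM exprVn sqr_sqrtr ?ler0n // scale_scalar_mx.
rewrite mulrN -exprMn mulVf ?pnatr_eq0 // expr1n raddfN.
by rewrite addNr.
Qed.
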